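(* Let $P=[p_{ij}]$ be the $m\times m$ transition matrix of a finite irreducible discrete time Markov chain with stationary probability vector $\pi^T$ and column sum vector $c^T=(c_1,\dots,c_m)$, $c_j=\sum_{i=1}^m p_{ij}$. Let $H=[I-P+ec^T]^{-1}$, $Z=[I-P+e\pi^T]^{-1}$ and $\Pi=e\pi^T$, where $e$ is the column vector of ones. Then: (a) $Z=H+\Pi-\Pi H$; (b) $H=Z+\frac1m\Pi-\frac1m ec^TZ$; (c) $(1+m)\Pi=m\Pi H+ec^TZ$; (d) $(1+m)\pi^T=m\pi^TH+c^TZ$.
   Context: The chain has state space $\{1,\dots,m\}$. $P$ is row-stochastic: $p_{ij}\ge 0$ and $\sum_{j=1}^m p_{ij}=1$ for all $i$. The stationary probability vector is the unique $\pi$ with $\pi^TP=\pi^T$ and $\pi^Te=1$. The matrices $I-P+ec^T$ and $I-P+e\pi^T$ are nonsingular, so $H$ and $Z$ (Kemeny and Snell's fundamental matrix) are well defined. *)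

(* Defs.v *)
From mathcomp Require Export all_boot all_order all_algebra.

Set Implicit Arguments.
Unset Strict Implicit.
Unset Printing Implicit Defensive.

Import GRing.Theory Num.Theory.
Local Open Scope ring_scope.

Definition row_stochastic (R : realFieldType) (m : nat) (P : 'M[R]_m) : Prop :=
  (forall i j, 0 <= P i j) /\ (forall i, \sum_j P i j = 1).

(* Every state is accessible from every state; [(P ^+ n) i j] is the n-step
   transition probability.  Allowing n = 0 is harmless: for a row-stochastic P,
   requiring n >= 1 gives the same condition. *)
Definition irreducible_chain (R : realFieldType) (m : nat) (P : 'M[R]_m) : Prop :=
  forall i j, exists n : nat, 0 < (P ^+ n) i j.

Definition ones (R : realFieldType) (m : nat) : 'cV[R]_m := const_mx 1.

(* The row vector [pi] stands for pi^T.  For an irreducible stochastic P these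
   two equations determine it uniquely and force its entries to be
   nonnegative.  There is no solution when m = 0. *)
Definition stationary (R : realFieldType) (m : nat) (P : 'M[R]_m)
    (pi : 'rV[R]_m) : Prop :=
  pi *m P = pi /\ pi *m ones R m = 1%:M.

Definition column_sums (R : realFieldType) (m : nat) (P : 'M[R]_m) : 'rV[R]_m :=
  \row_j \sum_i P i j.

(* Main.v *)
(* By the maximum principle, irreducibility makes ker (I - P) the line spanned
   by e, so I - P + e u is invertible for every row vector u with u e <> 0; both
   u = c (c e = m) and u = pi (pi e = 1) qualify.  The inverses satisfy
   H e = e / m, c H = pi, Z e = e and pi Z = pi, and the resolvent identities
   Z - H = Z (e c - e pi) H and H - Z = H (e pi - e c) Z give (a) and (b).
   Multiplying (b) by m pi yields (d), and (c) is e times (d). *)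

Require Import Defs.
From mathcomp Require Import all_boot all_order all_algebra.

Set Implicit Arguments.
Unset Strict Implicit.

Import GRing.Theory Num.Theory.
Local Open Scope ring_scope.

Lemma unitmx_inj_cV (F : fieldType) (m : nat) (A : 'M[F]_m) :
  (forall v : 'cV_m, A *m v = 0 -> v = 0) -> A \in unitmx.
Proof.
move=> injA; rewrite -unitmx_tr -row_free_unit; apply: inj_row_free => v vA0.
apply: trmx_inj; rewrite trmx0; apply: injA.
by rewrite -[A]trmxK -trmx_mul vA0 trmx0.
Qed.

Lemma invmx_sub (F : fieldType) (m : nat) (A B : 'M[F]_m) :
  A \in unitmx -> B \in unitmx ->
  invmx B - invmx A = invmx B *m (A - B) *m invmx A.
Proof.
by move=> uA uB; rewrite mulmxBr mulmxBl mulmxK // mulVmx // mul1mx.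
Qed.

Section Chain.

Variables (R : realFieldType) (m : nat) (P : 'M[R]_m) (pi : 'rV[R]_m).
Hypotheses (stochP : row_stochastic P) (irrP : irreducible_chain P).
Hypothesis statpi : stationary P pi.

Local Notation e := (ones R m).

Lemma stochastic_ones : P *m e = e.
Proof.
apply/matrixP=> i j; rewrite !mxE -[RHS](stochP.2 i).
by apply: eq_bigr => k _; rewrite mxE mulr1.
Qed.

Lemma expmx_fixed (v : 'cV[R]_m) n : P *m v = v -> P ^+ n *m v = v.
Proof.
move=> Pv; elim: n => [|n IHn]; first by rewrite expr0 mul1mx.
by rewrite exprS -[_ * _]/(_ *m _) -mulmxA IHn.
Qed.

Lemma expmx_ge0 n i j : 0 <= (P ^+ n) i j.
Proof.
elim: n i j => [|n IHn] i j; first by rewrite expr0 mxE ler0n.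
rewrite exprS mxE; apply: sumr_ge0 => k _.
by rewrite mulr_ge0 // (stochP.1 i k).
Qed.

(** Maximum principle: at a state [i] where [v] is largest, [v i 0] is a weighted average of the
    entries of [v] with weights [(P ^+ n) i k]. An entry with positive weight must therefore equal
    the maximum, and irreducibility supplies such an [n] for each [j]. *)
Lemma harmonic_const (v : 'cV[R]_m) :
  P *m v = v -> exists t, v = t *: e.
Proof.
(* A maximiser needs some state to exist, so [m = 0] is split off; there any [t] works. *)
move=> Pv; case: (pickP (fun _ : 'I_m => true)) => [i0 _ | m0]; last first.
  by exists 0; apply/matrixP=> i; have := m0 i.
case: (@Order.TotalTheory.arg_maxP _ R 'I_m i0 predT (fun i => v i 0)) => // i _ maxi.
exists (v i 0); apply/colP=> j; rewrite !mxE mulr1.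
have [n Pn_gt0] := irrP i j.
(* [P ^+ n] fixes both [e] and [v], so the sum is [v i 0 * 1 - v i 0]. *)
have sum0 : \sum_k (P ^+ n) i k * (v i 0 - v k 0) = 0.
  have /matrixP/(_ i 0) Pnv := expmx_fixed n Pv.
  have /matrixP/(_ i 0) Pne := expmx_fixed n stochastic_ones.
  rewrite !mxE in Pnv Pne.
  under eq_bigr do rewrite mulrBr.
  rewrite sumrB Pnv -mulr_suml; apply/eqP; rewrite subr_eq0; apply/eqP.
  rewrite -[RHS]mul1r -Pne; congr (_ * _).
  by apply: eq_bigr => k _; rewrite mxE mulr1.
have term_ge0 k : true -> 0 <= (P ^+ n) i k * (v i 0 - v k 0).
  by move=> _; rewrite mulr_ge0 ?expmx_ge0 // subr_ge0; apply: maxi.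
have /eqP := psumr_eq0P term_ge0 sum0 (erefl : true = true :> bool) (i := j).
by rewrite mulf_eq0 (negbTE (lt0r_neq0 Pn_gt0)) subr_eq0 => /eqP.
Qed.

Lemma stationary_size_neq0 : m%:R != 0 :> R.
Proof.
rewrite pnatr_eq0; apply/eqP=> m0.
have /matrixP/(_ 0 0) := statpi.2; rewrite !mxE big1 => [/esym/eqP|k _].
  by rewrite oner_eq0.
by have := ltn_ord k; rewrite [X in (_ < X)%N]m0 ltn0.
Qed.

Lemma column_sums_ones : column_sums P *m e = m%:R%:M.
Proof.
apply/matrixP=> i j; rewrite !ord1 !mxE.
under eq_bigr do rewrite !mxE mulr1.
rewrite exchange_big /=; under eq_bigr do rewrite stochP.2.
by rewrite sumr_const card_ord.
Qed.

(** If [v] is in the kernel, multiplying by [pi] on the left kills [1%:M - P] and leaves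
    [u *m v = 0]. Then [P *m v = v], so [v = t *: e], and [u *m v = 0] reads [t * a = 0]. *)
Lemma perturbed_unitmx (u : 'rV[R]_m) (a : R) :
  u *m e = a%:M -> a != 0 -> 1%:M - P + e *m u \in unitmx.
Proof.
move=> ue a_neq0; apply: unitmx_inj_cV => v Av0.
have uv0 : u *m v = 0.
  have := congr1 (mulmx pi) Av0; rewrite mulmx0 mulmxA mulmxDr mulmxBr mulmx1.
  by rewrite statpi.1 subrr add0r mulmxA statpi.2 mul1mx.
have [t vE] : exists t, v = t *: e.
  apply: harmonic_const; apply/eqP; rewrite eq_sym -subr_eq0; apply/eqP.
  by rewrite -[RHS]Av0 mulmxDl mulmxBl mul1mx -mulmxA uv0 mulmx0 addr0.
move: uv0; rewrite vE -scalemxAr ue => /matrixP/(_ 0 0)/eqP.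
rewrite !mxE mulr1n mulf_eq0 (negbTE a_neq0) orbF => /eqP ->.
by rewrite scale0r.
Qed.

(** Since [1%:M - P] kills [e], the perturbed matrix has [e] as an eigenvector with eigenvalue
    [a]. *)
Lemma perturbed_inv_ones (u : 'rV[R]_m) (a : R) :
  u *m e = a%:M -> a != 0 -> invmx (1%:M - P + e *m u) *m e = a^-1 *: e.
Proof.
move=> ue a_neq0; have uA := perturbed_unitmx ue a_neq0.
apply: (canLR (mulKmx uA)); rewrite -scalemxAr mulmxDl mulmxBl mul1mx.
rewrite stochastic_ones subrr add0r -mulmxA ue mul_mx_scalar scalerA.
by rewrite mulVf ?scale1r.
Qed.

(** Since [pi] kills [1%:M - P] from the left and [pi *m e = 1], it is sent to [u] by the perturbed
    matrix, whatever [a] is. *)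
Lemma perturbed_inv_row (u : 'rV[R]_m) (a : R) :
  u *m e = a%:M -> a != 0 -> u *m invmx (1%:M - P + e *m u) = pi.
Proof.
move=> ue a_neq0; have uA := perturbed_unitmx ue a_neq0.
apply: (canLR (mulmxK uA)); rewrite mulmxDr mulmxBr mulmx1 statpi.1.
by rewrite subrr add0r mulmxA statpi.2 mul1mx.
Qed.

End Chain.

Theorem theorem4 (R : realFieldType) (m : nat) (P : 'M[R]_m) (pi : 'rV[R]_m)
    (stochP : row_stochastic P) (irrP : irreducible_chain P)
    (statpi : stationary P pi) :
  let e := ones R m in
  let c := column_sums P in
  let Pi := e *m pi in
  let H := invmx (1%:M - P + e *m c) in
  let Z := invmx (1%:M - P + e *m pi) in
  [/\ Z = H + Pi - Pi *m H,
      H = Z + m%:R^-1 *: Pi - m%:R^-1 *: (e *m c *m Z),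
      (1 + m%:R) *: Pi = m%:R *: (Pi *m H) + e *m c *m Z
    & (1 + m%:R) *: pi = m%:R *: (pi *m H) + c *m Z].
Proof.
move=> e c Pi H Z.
have m_neq0 := stationary_size_neq0 statpi.
have ce := column_sums_ones stochP; have pie := statpi.2.
have uH := perturbed_unitmx stochP irrP statpi ce m_neq0.
have uZ := perturbed_unitmx stochP irrP statpi pie (oner_neq0 R).
have He : H *m e = m%:R^-1 *: e := perturbed_inv_ones stochP irrP statpi ce m_neq0.
have cH : c *m H = pi := perturbed_inv_row stochP irrP statpi ce m_neq0.
have Ze : Z *m e = e.
  by rewrite (perturbed_inv_ones stochP irrP statpi pie) ?oner_neq0 // invr1 scale1r.
have piZ : pi *m Z = pi :=
  perturbed_inv_row stochP irrP statpi pie (oner_neq0 R).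
have eqa : Z = H + Pi - Pi *m H.
  rewrite -addrA; apply: (canRL (subrKC _)).
  (* The [1%:M - P] parts cancel in the difference, leaving the rank-one middle factor
     [e *m (c - pi)], which [Z] on the left does not change. *)
  rewrite (invmx_sub uH uZ) opprD addrACA subrr add0r -mulmxBr mulmxA Ze.
  by rewrite -mulmxA mulmxBl cH mulmxBr mulmxA.
have eqb : H = Z + m%:R^-1 *: Pi - m%:R^-1 *: (e *m c *m Z).
  rewrite -addrA; apply: (canRL (subrKC _)).
  rewrite (invmx_sub uZ uH) opprD addrACA subrr add0r -mulmxBr mulmxA He.
  by rewrite -!scalemxAl -mulmxA mulmxBl piZ mulmxBr mulmxA scalerBr.
have eqd : (1 + m%:R) *: pi = m%:R *: (pi *m H) + c *m Z.
  rewrite [in RHS]eqb mulmxBr mulmxDr piZ -!scalemxAr !mulmxA pie !mul1mx.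
  rewrite scalerBr scalerDr !scalerA mulfV // !scale1r subrK.
  by rewrite scalerDl scale1r addrC.
by split=> //; rewrite /Pi scalemxAr eqd mulmxDr -scalemxAr !mulmxA.
Qed.
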